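(* Let $\Gamma$ be a finitely generated group with finite generating set $X$, let $S\subset\Gamma\setminus\{1\}$ be a finite set, and let $\delta\in\Gamma\setminus\{1\}$ have the following property: for any homomorphism $\varphi:\Gamma\to Q$ to a group $Q$, if $\ker\varphi\cap S\neq\emptyset$, then $\delta\in\ker\varphi$. Then $\mathrm{lcm}_{\Gamma,X}(S)\le\|\delta\|_X$.
   Context: $\|\cdot\|_X$ denotes word length with respect to $X$. For a finite set $S$ of nontrivial elements of $\Gamma$, let $L_S=\bigcap_{\gamma\in S}\overline{\langle\gamma\rangle}$, where $\overline{\langle\gamma\rangle}$ is the normal closure in $\Gamma$ of the cyclic subgroup generated by $\gamma$. Let $\mathrm{LCM}_{\Gamma,X}(S)$ be the set of nontrivial elements of $L_S$ of minimal word length among nontrivial elements of $L_S$. Define $\mathrm{lcm}_{\Gamma,X}(S)=\|\eta\|_X$ for any $\eta\in\mathrm{LCM}_{\Gamma,X}(S)$ if this set is nonempty, and $\mathrm{lcm}_{\Gamma,X}(S)=0$ if it is empty. *)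

(* Defs.v *)
From HB Require Import structures.
From mathcomp Require Import all_boot.
From mathcomp Require Import boolp classical_sets cardinality.
Set Implicit Arguments.
Unset Strict Implicit.
Unset Printing Implicit Defensive.
Local Open Scope classical_set_scope.
Local Open Scope group_scope.

Section Groups.
Variable G : groupType.
Implicit Types (A H X S : set G) (g x y : G).

Definition is_subgroup H : Prop := group_closed (mem H).

Definition is_normal_subgroup H : Prop :=
  is_subgroup H /\ forall x y, H x -> H (x ^ y).

Definition generated A : set G := smallest is_subgroup A.

Definition normal_closure A : set G := smallest is_normal_subgroup A.

Definition generates X : Prop := generated X = setT.

Definition is_word X (w : seq G) : Prop :=
  forall y, y \in w -> X y \/ X y^-1.

Definition has_word_of_size X g (n : nat) : Prop :=
  exists w : seq G, [/\ is_word X w, \prod_(y <- w) y = g & size w = n].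

Lemma generates_word X g : generates X -> exists n, has_word_of_size X g n.
Proof.
move=> genX; have: generated X g by rewrite genX.
apply: (@smallest_sub _ _ _ [set h | exists n, has_word_of_size X h n]) g.
  split=> [|x y].
    by apply: mem_set; exists 0%N, [::]; rewrite big_nil.
  move=> /set_mem[m [v [Xv <- _]]] /set_mem[n [w [Xw <- _]]]; apply: mem_set.
  exists (size (v ++ rev [seq z^-1 | z <- w])), (v ++ rev [seq z^-1 | z <- w]).
  split=> // [z|].
    rewrite mem_cat mem_rev => /orP[/Xv //|/mapP[t /Xw Xt ->]].
    by rewrite invgK; case: Xt; [right|left].
  rewrite big_cat /=; congr (_ * _).
  elim: w {Xw} => [|t w IHw]; first by rewrite !big_nil invg1.
  by rewrite big_cons invgM -IHw map_cons rev_cons -cats1 big_cat big_seq1.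
move=> x Xx; exists 1%N, [:: x]; rewrite big_seq1; split=> // z.
by rewrite inE => /eqP->; left.
Qed.

(* The value 0 for unrepresentable [g] is junk: by [generates_word] it does not
   occur when [X] generates [G]. *)
Definition word_length X g : nat :=
  if pselect (exists n, `[< has_word_of_size X g n >]) is left ex
  then ex_minn ex else 0%N.

(* For [S = set0] the empty intersection is the whole group. *)
Definition lcm_subgroup S : set G :=
  \bigcap_(gamma in S) normal_closure (generated [set gamma]).

Definition LCM X S : set G :=
  [set eta | [/\ lcm_subgroup S eta, eta <> 1 &
    forall zeta, lcm_subgroup S zeta -> zeta <> 1 ->
      (word_length X eta <= word_length X zeta)%N]].

Definition lcm X S : nat :=
  if pselect (exists eta, LCM X S eta) is left ex
  then word_length X (projT1 (cid ex)) else 0%N.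

Lemma lcmE X S eta : LCM X S eta -> lcm X S = word_length X eta.
Proof.
move=> Leta; rewrite /lcm; case: pselect => [ex|[]]; last by exists eta.
have [Lz z1 zmin] := projT2 (cid ex); have [Le e1 emin] := Leta.
by apply/eqP; rewrite eqn_leq zmin ?emin.
Qed.

End Groups.

Definition kernel (G Q : groupType) (phi : {multiplicative G -> Q}) : set G :=
  [set g | phi g = 1].

(* Main.v *)
Require Import Defs.
From HB Require Import structures.
From mathcomp Require Import all_boot.
From mathcomp Require Import boolp classical_sets cardinality.
Local Open Scope classical_set_scope.
Local Open Scope group_scope.

(** Testing the hypothesis on the quotient of [Gamma] by the normal closure of
    [gamma], for each [gamma] in [S], shows that [delta] lies in the subgroup
    [L_S]; being nontrivial, it is at least as long as the shortest nontrivial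
    elements of [L_S]. *)

Lemma generated_set1 (G : groupType) (x : G) : generated [set x] x.
Proof. exact: sub_gen_smallest. Qed.

Lemma normal_closure_sub (G : groupType) (A : set G) : A `<=` normal_closure A.
Proof. exact: sub_gen_smallest. Qed.

(** Intersections preserve normality: each closure condition is checked inside an arbitrary normal
    subgroup [N] containing [A]. *)
Lemma normal_closure_normal (G : groupType) (A : set G) :
  is_normal_subgroup (normal_closure A).
Proof.
split=> [|x y Ax N [nN AN]]; last by case: (nN) => _; apply; apply: Ax.
split=> [|x y /set_mem Ax /set_mem Ay]; apply: mem_set => N [nN AN];
  have [[N1 NB] _] := nN; first exact: set_mem.
by apply/set_mem/NB; apply: mem_set; [apply: Ax|apply: Ay].
Qed.

Section Quotient.
Local Open Scope quotient_scope.
Variables (G : groupType) (N : set G).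
Hypothesis nN : is_normal_subgroup N.
Implicit Types x y z : G.

Let N1 : N 1. Proof. by case: nN => [[/set_mem]]. Qed.

Let NB x y : N x -> N y -> N (x / y).
Proof.
by case: nN => [[_ NB] _] Nx Ny; apply/set_mem/NB; apply: mem_set.
Qed.

Let NV x : N x -> N x^-1. Proof. by rewrite -div1g; apply: NB. Qed.

Let NM x y : N x -> N y -> N (x * y).
Proof. by move=> Nx /NV; rewrite -{2}[y]invgK; apply: NB. Qed.

Let NJ x y : N x -> N (x ^ y). Proof. by case: nN => _; apply. Qed.

(** As [x / y] is [x * y^-1], the classes are the cosets [N x]. Membership in [N] is made boolean
    classically, since the quotient construction takes a boolean relation. *)
Definition coset_rel : rel G := fun x y => `[< N (x / y) >].

Let coset_relP x y : reflect (N (x / y)) (coset_rel x y).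
Proof. exact: asboolP. Qed.

Lemma coset_rel_refl : reflexive coset_rel.
Proof. by move=> x; apply/coset_relP; rewrite divgg. Qed.

Lemma coset_rel_sym : symmetric coset_rel.
Proof.
by move=> x y; apply/coset_relP/coset_relP => /NV; rewrite invgM invgK.
Qed.

Lemma coset_rel_trans : transitive coset_rel.
Proof.
move=> y x z /coset_relP Nxy /coset_relP Nyz; apply/coset_relP.
by have := NM _ _ Nxy Nyz; rewrite mulgA mulgVK.
Qed.

Canonical coset_equiv :=
  EquivRel coset_rel coset_rel_refl coset_rel_sym coset_rel_trans.

Definition quotient_group : Type := {eq_quot coset_equiv}.
HB.instance Definition _ := Choice.on quotient_group.

Definition coset (x : G) : quotient_group := \pi_({eq_quot coset_equiv}) x.
Definition coset_repr (a : quotient_group) : G :=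
  repr (a : {eq_quot coset_equiv}).

Let coset_reprK a : coset (coset_repr a) = a. Proof. exact: reprK. Qed.

Lemma eq_coset x y : coset x = coset y <-> N (x / y).
Proof.
split=> [/eqmodP/coset_relP //|Nxy].
by apply/eqmodP/coset_relP.
Qed.

Definition quotient_mul a b := coset (coset_repr a * coset_repr b).
Definition quotient_inv a := coset (coset_repr a)^-1.

(** The product does not depend on the chosen representatives; this is where normality of [N]
    enters. *)
Lemma quotient_mulE x y : quotient_mul (coset x) (coset y) = coset (x * y).
Proof.
have [/eq_coset Nx /eq_coset Ny] := (coset_reprK (coset x), coset_reprK (coset y)).
rewrite /quotient_mul; move: (coset_repr _) Nx (coset_repr _) Ny => x' Nx y' Ny.
apply/eq_coset.
(* Conjugating by [x'^-1] moves the error [y' / y] to the left of [x'], leaving a product of two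
   elements of [N]. *)
suff -> : x' * y' / (x * y) = (y' / y) ^ x'^-1 * (x' / x) by apply/NM/Nx/NJ.
by rewrite conjgE invgK invgM !mulgA mulgVK.
Qed.

Lemma quotient_invE x : quotient_inv (coset x) = coset x^-1.
Proof.
have /eq_coset := coset_reprK (coset x).
(* Inverting [x' / x] and conjugating by [x'] gives [x'^-1 * x], which is the quotient of [x'^-1] by
   [x^-1]. *)
rewrite /quotient_inv; move: (coset_repr _) => x' /NV/(NJ _ x') Nx; apply/eq_coset.
by move: Nx; rewrite conjgE invgM !invgK !mulgA mulgVK.
Qed.

Lemma quotient_mulA : associative quotient_mul.
Proof.
move=> a b c; rewrite -[a]coset_reprK -[b]coset_reprK -[c]coset_reprK.
by rewrite !quotient_mulE mulgA.
Qed.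

Lemma quotient_mul1g : left_id (coset 1) quotient_mul.
Proof. by move=> a; rewrite -[a]coset_reprK quotient_mulE mul1g. Qed.

Lemma quotient_mulg1 : right_id (coset 1) quotient_mul.
Proof. by move=> a; rewrite -[a]coset_reprK quotient_mulE mulg1. Qed.

Lemma quotient_mulVg : left_inverse (coset 1) quotient_inv quotient_mul.
Proof.
by move=> a; rewrite -[a]coset_reprK quotient_invE quotient_mulE mulVg.
Qed.

Lemma quotient_mulgV : right_inverse (coset 1) quotient_inv quotient_mul.
Proof.
by move=> a; rewrite -[a]coset_reprK quotient_invE quotient_mulE mulgV.
Qed.

HB.instance Definition _ := isGroup.Build quotient_group quotient_mulA
  quotient_mul1g quotient_mulg1 quotient_mulVg quotient_mulgV.

Lemma coset_morphM : {morph coset : x y / x * y}.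
Proof. by move=> x y; rewrite -quotient_mulE. Qed.

HB.instance Definition _ :=
  isMultiplicative.Build G quotient_group coset coset_morphM.

(** The unit of the quotient is [coset 1], so the kernel condition reads [N (x / 1)]. Every normal
    subgroup is thus a kernel. *)
Lemma kernel_coset : kernel coset = N.
Proof.
apply/seteqP; split=> x; first by move=> /eq_coset; rewrite divg1.
by move=> Nx; apply/eq_coset; rewrite divg1.
Qed.

End Quotient.

Lemma lcm_le_word_length (G : groupType) (X S : set G) (x : G) :
  lcm_subgroup S x -> x <> 1 -> (lcm X S <= word_length X x)%N.
Proof.
(* If [LCM X S] is empty, [lcm] takes its default value 0 and the bound is trivial; otherwise the
   chosen element is minimal. *)
rewrite /lcm; case: pselect => // ex Lx x1.
by have [_ _] := projT2 (cid ex); apply.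
Qed.

Theorem lemma3p1 (Gamma : groupType) (X : set Gamma)
    (finX : finite_set X) (genX : generates X)
    (S : set Gamma) (finS : finite_set S) (S1 : S `<=` [set~ 1])
    (delta : Gamma) (delta1 : delta <> 1)
    (Hdelta : forall (Q : groupType) (phi : {multiplicative Gamma -> Q}),
       kernel phi `&` S !=set0 -> kernel phi delta) :
  (lcm X S <= word_length X delta)%N.
Proof.
apply: lcm_le_word_length => // gamma Sgamma.
have nN := normal_closure_normal _ (generated [set gamma]).
(* With the normal closure written as a kernel, [Hdelta] applies to the projection [coset], and
   [gamma] itself witnesses that this kernel meets [S]. *)
rewrite -(kernel_coset _ _ nN); apply: Hdelta; exists gamma; split=> //.
by rewrite kernel_coset; apply: normal_closure_sub; apply: generated_set1.
Qed.
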